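(* Fix a positive integer $k$ with $k \ge 4$ and $k \equiv 0 \pmod 4$. There are constants $c_1, c_2>0$ depending only on $k$ such that, for all $n$ (with $k\le 2^n$), $$c_1 n^{k/4} < f(n,k) < c_2 n^{k/4}.$$
   Context: $Q_n$ denotes the $n$-dimensional hypercube: its vertices are the binary vectors of length $n$ (equivalently subsets of $\{1,\dots,n\}$), two vertices adjacent iff they differ in exactly one coordinate. $C_k$ denotes the cycle of length $k$. For even $k$ with $4\le k\le 2^n$, $f(n,k)$ is the minimum number of colors in an edge-coloring of $Q_n$ such that the edges of every copy of $C_k$ in $Q_n$ (every subgraph of $Q_n$ isomorphic to $C_k$) receive $k$ distinct colors. *)

(* Defs.v *)
From mathcomp Require Import all_boot.

Set Implicit Arguments.
Unset Strict Implicit.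
Unset Printing Implicit Defensive.

Notation vertex n := {ffun 'I_n -> bool}.

Definition adj n : rel (vertex n) :=
  fun x y => #|[set i | x i != y i]| == 1.

Definition edges n : {set {set vertex n}} :=
  [set e | [exists x : vertex n, exists y, adj x y && (e == [set x; y])]].

Notation edge n := {e : {set vertex n} | e \in edges n}.

(* A copy of C_k in Q_n is presented by a cyclic listing of its k distinct
   vertices; the same copy has 2k such listings. Without 2 < k, the sequence
   [:: x; y] with x and y adjacent would count as a cycle. *)
Definition is_Ck n k (p : k.-tuple (vertex n)) : bool :=
  (2 < k) && ucycleb (@adj n) p.

Definition cycle_edges n (p : seq (vertex n)) : {set {set vertex n}} :=
  [set [set x; next p x] | x in p].

Definition cycle_colors n m (c : {ffun edge n -> 'I_m}) (p : seq (vertex n)) :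
    {set 'I_m} :=
  [set c e | e : edge n & val e \in cycle_edges p].

(* The colorings c need not be proper. *)
Definition rainbow n k m (c : {ffun edge n -> 'I_m}) : bool :=
  [forall p : k.-tuple (vertex n), is_Ck p ==> (#|cycle_colors c p| == k)].

Definition colorable n k m : bool :=
  [exists c : {ffun edge n -> 'I_m}, rainbow k c].

Lemma next2_neq (T : eqType) (p : seq T) x :
  uniq p -> 2 < size p -> x \in p -> next p (next p x) != x.
Proof.
move=> Up sp xp; case: (rot_to xp) => i q Eq.
rewrite -!(next_rot i Up) Eq.
have: uniq (x :: q) by rewrite -Eq rot_uniq.
have: 2 < size (x :: q) by rewrite -Eq size_rot.
case: q {Eq} => [|a [|b q]] //= _.
rewrite !inE !negb_or eqxx => /and4P[/and3P[xa xb _] _ _ _].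
by rewrite [a == x]eq_sym (negbTE xa) eqxx eq_sym.
Qed.

Lemma card_cycle_edges n k (p : k.-tuple (vertex n)) :
  is_Ck p -> #|cycle_edges p| = k.
Proof.
case/andP=> k2 /andP[_ Up].
have sp : 2 < size p by rewrite size_tuple.
rewrite card_in_imset; first by rewrite (card_uniqP Up) size_tuple.
move=> x y xp yp E; apply/eqP; apply: contraT => nxy.
have : x \in [set y; next p y] by rewrite -E set21.
have : y \in [set x; next p x] by rewrite E set21.
rewrite !inE (negbTE nxy) eq_sym (negbTE nxy) /= => /eqP -> /eqP Ex.
by have := next2_neq Up sp xp; rewrite -Ex eqxx.
Qed.

Lemma cycle_edges_sub n k (p : k.-tuple (vertex n)) :
  is_Ck p -> cycle_edges p \subset edges n.
Proof.
case/andP=> _ /andP[Cp _]; apply/subsetP=> _ /imsetP[x xp ->].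
rewrite inE; apply/existsP; exists x; apply/existsP; exists (next p x).
by rewrite (next_cycle Cp xp) eqxx.
Qed.

Lemma colorable_ex n k : exists m, colorable n k m.
Proof.
exists #|{: edge n}|; apply/existsP; exists [ffun e => enum_rank e].
apply/forallP=> p; apply/implyP=> Cp; apply/eqP.
rewrite card_imset => [|e1 e2]; last by rewrite !ffunE => /enum_rank_inj.
rewrite -[RHS](card_cycle_edges Cp) -(card_imset _ val_inj).
apply: eq_card => e; apply/imsetP/idP => [[e' +  ->] | ep].
  by rewrite inE.
have eE := subsetP (cycle_edges_sub Cp) e ep.
by exists (exist _ e eE); rewrite ?inE.
Qed.

Definition f n k : nat := ex_minn (colorable_ex n k).

(* Main.v *)
(* Write k = 4t.
   Upper bound. Color the edge {A, A + i} by i, the parity of |A|, and the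
   syndrome of A for a BCH code of length n over F_2 with t - 1 syndromes in a
   field with between n and 2n elements. Two edges of a C_4t have endpoints at
   distance at most 2t - 1; if they also have the same direction and parity,
   their base points are at distance at most 2t - 2, where syndromes are
   injective.
   Lower bound. Among the edges {A, A + x} with |A| = t - 1, about n^t can be
   chosen with enough coordinates left unused that any two of them lie on a
   common C_4t, so they all get different colors. *)
Require Import Defs.
From mathcomp Require Import all_boot all_order all_algebra all_field reals.
From mathcomp Require Import zify.
Import Order.TTheory GRing.Theory Num.Theory.

Set Implicit Arguments.
Unset Strict Implicit.
Unset Printing Implicit Defensive.

(** * Hamming distance, coordinate flips and edges of the cube *)

Definition hamming n (x y : vertex n) : nat := #|[set i | x i != y i]|.

Definition flip n (x : vertex n) (i : 'I_n) : vertex n :=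
  [ffun j => x j (+) (j == i)].

Lemma flipE n (x : vertex n) i j : flip x i j = x j (+) (j == i).
Proof. exact: ffunE. Qed.

Lemma hammingxx n (x : vertex n) : hamming x x = 0.
Proof. by apply/eqP; rewrite cards_eq0; apply/eqP/setP=> i; rewrite !inE eqxx. Qed.

Lemma hamming_sym n (x y : vertex n) : hamming x y = hamming y x.
Proof. by apply: eq_card => i; rewrite !inE eq_sym. Qed.

Lemma hamming_triangle n (y x z : vertex n) :
  hamming x z <= hamming x y + hamming y z.
Proof.
apply: leq_trans (leq_card_setU _ _); apply/subset_leq_card/subsetP => i.
by rewrite !inE; do 3!case: (_ i).
Qed.

Lemma flipK n (i : 'I_n) : involutive (@flip n ^~ i).
Proof. by move=> x; apply/ffunP=> j; rewrite !ffunE addbK. Qed.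

Lemma adj_flip n (x : vertex n) i : adj x (flip x i).
Proof.
apply/eqP; rewrite -(cards1 i); apply: eq_card => j.
by rewrite !inE ffunE; case: (x j); case: (j == i).
Qed.

Lemma adjP n (x y : vertex n) : reflect (exists i, y = flip x i) (adj x y).
Proof.
apply: (iffP idP) => [/cards1P[i Ei]|[i ->]]; last exact: adj_flip.
exists i; apply/ffunP=> j; rewrite !ffunE.
by have/setP/(_ j) := Ei; rewrite !inE; case: (x j); case: (y j) => <-.
Qed.

(** Of the two endpoints, the one with the differing coordinate clear is taken as base; if the given
    endpoint has it set, the other one is used. *)
Lemma edgeP n (e : edge n) :
  exists (x : vertex n) i, x i = false /\ val e = [set x; flip x i].
Proof.
case: e => e /=; rewrite inE => /existsP[x /existsP[y /andP[/adjP[i ->] /eqP ->]]].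
case xi: (x i); last by exists x, i.
by exists (flip x i), i; rewrite flipK setUC ffunE xi eqxx.
Qed.

Lemma hamming_path n (p : seq (vertex n)) x i j :
  path (@adj n) x p -> i <= j <= size p ->
  hamming (nth x (x :: p) i) (nth x (x :: p) j) <= j - i.
Proof.
move=> Pp; elim: j => [|j IH] /andP[ij jp].
  by move: ij; rewrite leqn0 => /eqP ->; rewrite hammingxx.
case: ltngtP ij => // [ij _|-> _]; last first.
  by rewrite subnn hammingxx.
apply: leq_trans (hamming_triangle (nth x (x :: p) j) _ _) _.
have -> : j.+1 - i = (j - i) + 1 by lia.
apply: leq_add; first by apply: IH; lia.
by rewrite leq_eqVlt; apply/orP; left; apply: (pathP x Pp).
Qed.

(* Deleting the two edges from the cycle leaves two paths of total length k - 2. *)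
Lemma Ck_edges_close n k (p : k.-tuple (vertex n)) e1 e2 :
  is_Ck p -> e1 \in cycle_edges p -> e2 \in cycle_edges p -> e1 != e2 ->
  exists x y, [/\ x \in e1, y \in e2 & (hamming x y).*2 <= k - 2].
Proof.
case/andP=> k2 /andP[Cp Up] /imsetP[x xp ->] /imsetP[y yp ->] ne12.
have nxy : y != x by apply: contraNneq ne12 => ->.
case: (rot_to xp) => r q Eq; rewrite -!(next_rot r Up) Eq.
move: Cp Up yp; rewrite -(rot_cycle r) -(rot_uniq r) -(mem_rot r) Eq.
move=> Cq Uq yq; have sq : (size q).+1 = k by rewrite -(size_tuple p) -(size_rot r p) Eq.
have {}Cq : path (@adj n) x (rcons q x) by [].
(* [P] closes up the cycle, so [x] sits at positions 0 and [k], and [y] at position [j]. *)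
set P := x :: rcons q x; set j := index y (x :: q).
have jk : j < k by rewrite -sq -[(size q).+1]/(size (x :: q)) index_mem.
have j0 : 0 < j by rewrite /j /= eq_sym (negbTE nxy).
have yE : y = nth x P j.
  by rewrite /P -rcons_cons nth_rcons /= sq jk nth_index.
have nE z : z \in x :: q -> next (x :: q) z = nth x P (index z (x :: q)).+1.
  by move=> zq; rewrite next_nth zq /= nth_rcons_default.
have d1 : hamming (next (x :: q) x) y <= j - 1.
  rewrite nE ?mem_head // yE /= eqxx.
  by apply: (@hamming_path n (rcons q x) x 1 j Cq); rewrite size_rcons sq; lia.
have d2 : hamming x (next (x :: q) y) <= k - j.+1.
  rewrite hamming_sym nE // -/j.
  have {2}-> : x = nth x P k by rewrite /P -sq /= nth_rcons ltnn eqxx.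
  by apply: (@hamming_path n (rcons q x) x j.+1 k Cq); rewrite size_rcons sq; lia.
(* The bounds [j - 1] and [k - j.+1] add up to [k - 2]; the smaller one is at most half of that. *)
case: (leqP j.*2 k) => jk2.
  exists (next (x :: q) x), y; rewrite set21 set22; split=> //; lia.
exists x, (next (x :: q) y); rewrite set21 set22; split=> //; lia.
Qed.

(** * Rainbow colorings as colorings injective on each cycle *)

Lemma card_cycle_edge n k (p : k.-tuple (vertex n)) :
  is_Ck p -> #|[set e : edge n | val e \in cycle_edges p]| = k.
Proof.
move=> Cp; rewrite -[RHS](card_cycle_edges Cp) -(card_imset _ val_inj).
apply: eq_card => e; apply/imsetP/idP => [[e' + ->] | ep]; first by rewrite inE.
have eE := subsetP (cycle_edges_sub Cp) e ep.
by exists (exist _ e eE); rewrite ?inE.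
Qed.

Lemma cycle_colorsE n m (c : {ffun edge n -> 'I_m}) (p : seq (vertex n)) :
  cycle_colors c p = c @: [set e : edge n | val e \in cycle_edges p].
Proof.
by apply/setP=> z; apply/imsetP/imsetP => -[e ep ->]; exists e; rewrite ?inE in ep *.
Qed.

(** A copy of C_k has exactly [k] edges, so seeing [k] colors on it means that no color repeats. *)
Lemma rainbowP n k m (c : {ffun edge n -> 'I_m}) :
  reflect (forall p : k.-tuple (vertex n), is_Ck p ->
             {in [pred e : edge n | val e \in cycle_edges p] &, injective c})
          (rainbow k c).
Proof.
apply: (iffP forallP) => [Rc p Cp | Rc p].
  have := implyP (Rc p) Cp.
  rewrite -{2}(card_cycle_edge Cp) cycle_colorsE => /imset_injP cI e1 e2 h1 h2.
  by apply: cI; rewrite inE.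
apply/implyP=> Cp; rewrite -{2}(card_cycle_edge Cp) cycle_colorsE.
by rewrite card_in_imset // => e1 e2; rewrite !inE; apply: Rc Cp e1 e2.
Qed.

Lemma f_min n k m : colorable n k m -> f n k <= m.
Proof. by rewrite /f; case: ex_minnP => m0 _; apply. Qed.

Lemma f_colorable n k : colorable n k (f n k).
Proof. by rewrite /f; case: ex_minnP. Qed.

Lemma f_le_card n k (C : finType) (c : edge n -> C) :
  (forall p : k.-tuple (vertex n), is_Ck p ->
     {in [pred e : edge n | val e \in cycle_edges p] &, injective c}) ->
  f n k <= #|C|.
Proof.
move=> Rc; apply/f_min/existsP; exists [ffun e => enum_rank (c e)].
apply/rainbowP=> p Cp e1 e2 h1 h2; rewrite !ffunE => /enum_rank_inj.
exact: Rc h1 h2.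
Qed.

(** * BCH syndromes over a field of characteristic 2 *)

Section Syndrome.
Local Open Scope ring_scope.

Variables (F : finFieldType) (char2 : 2 \in [pchar F]).
Variables (n : nat) (a : 'I_n -> F).
Hypotheses (a_inj : injective a) (a_neq0 : forall i, a i != 0).

Definition power_sum (x : vertex n) (e : nat) : F :=
  \sum_i (x i)%:R * a i ^+ e.

(* The syndrome of the narrow-sense BCH code of designed distance 2 s + 1. *)
Definition syndrome s (x : vertex n) : {ffun 'I_s -> F} :=
  [ffun l : 'I_s => power_sum x l.*2.+1].

Definition vxor (x y : vertex n) : vertex n := [ffun i => x i (+) y i].

Lemma power_sum_vxor x y e :
  power_sum (vxor x y) e = power_sum x e + power_sum y e.
Proof.
rewrite -big_split; apply: eq_bigr => i _ /=; rewrite ffunE -mulrDl.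
congr (_ * _); case: (x i); case: (y i); rewrite ?addr0 ?add0r //=.
by rewrite -mulr2n (pcharf0 char2).
Qed.

(** Squaring is additive in characteristic 2 and fixes the coefficients 0 and 1. *)
Lemma power_sum_double x e : power_sum x e.*2 = power_sum x e ^+ 2.
Proof.
rewrite -(pFrobenius_autE char2) rmorph_sum; apply: eq_bigr => i _ /=.
rewrite rmorphM /= pFrobenius_aut_nat pFrobenius_autE.
by rewrite -exprM muln2.
Qed.

(** Odd exponents are entries of the syndrome; an even exponent reduces to its half by squaring. *)
Lemma power_sum_eq0 s z :
  syndrome s z = [ffun => 0] -> forall e, (0 < e <= s.*2)%N -> power_sum z e = 0.
Proof.
move=> z0 e; have [b] := ubnP e; elim: b e => // b IH e eb es.
case oe: (odd e); have := odd_double_half e; rewrite oe.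
  move=> <-; have hs : (e./2 < s)%N by lia.
  by have /ffunP/(_ (Ordinal hs)) := z0; rewrite !ffunE.
by rewrite add0n => <-; rewrite power_sum_double IH ?expr0n //; lia.
Qed.

(* Evaluate at the points of the support of z the polynomial that vanishes at 0
   and at all of them but one. *)
Lemma power_sum_support s z :
  (forall e, (0 < e <= s.*2)%N -> power_sum z e = 0) ->
  (#|[set i | z i]| <= s.*2)%N -> forall i, z i = false.
Proof.
move=> z0 zs i0; apply/negbTE/negP => zi0.
set D := [set i | z i] in zs; have i0D : i0 \in D by rewrite inE.
(* The factor ['X] removes the constant term, since nothing is known about the power sum of exponent
   0. The degree is the size of the support, at most [s.*2]. *)
pose P := \prod_(j <- enum (D :\ i0)) ('X - (a j)%:P) * 'X.
have sP : (size P <= s.*2.+1)%N.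
  rewrite size_mulX ?size_prod_XsubC -?size_poly_eq0 ?size_prod_XsubC //.
  by rewrite -cardE ltnS (leq_trans _ zs) // (cardsD1 i0 D) i0D.
have : \sum_i (z i)%:R * P.[a i] = 0.
  under eq_bigr => i _ do rewrite (horner_coef_wide _ sP) mulr_sumr.
  rewrite exchange_big big1 //= => e _.
  under eq_bigr => i _ do rewrite mulrCA.
  rewrite -mulr_sumr -/(power_sum z e); case: (posnP e) => [-> | e0].
    by rewrite coefMX mul0r.
  by rewrite z0 ?mulr0 //; have := ltn_ord e; lia.
(* Only the term at [i0] survives, and it is nonzero because the points are distinct and nonzero. *)
rewrite (bigD1 i0) //= big1 => [|i ii0]; last first.
  case zi: (z i); last by rewrite mul0r.
  rewrite hornerM horner_prod (big_rem i) /= ?mem_enum ?inE ?ii0 //.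
  by rewrite hornerXsubC subrr !mul0r mulr0.
rewrite addr0 zi0 mul1r => /eqP; apply/negP.
rewrite hornerM hornerX mulf_neq0 // horner_prod prodf_seq_neq0.
apply/allP => j; rewrite mem_enum !inE => /andP[ji0 _] /=.
by rewrite hornerXsubC subr_eq0 (inj_eq a_inj) eq_sym.
Qed.

(** By additivity the symmetric difference of [x] and [y] has zero syndrome, and its support is too
    small for that unless it is empty. *)
Lemma syndrome_inj s x y :
  (hamming x y <= s.*2)%N -> syndrome s x = syndrome s y -> x = y.
Proof.
move=> dxy /ffunP sxy; apply/ffunP=> i.
have vx j : vxor x y j = (x j != y j) by rewrite ffunE; case: (x j); case: (y j).
apply/eqP; apply: contraFT (_ : vxor x y i = false); first by rewrite vx.
apply: (@power_sum_support s).
  apply: power_sum_eq0; apply/ffunP => l; rewrite ffunE power_sum_vxor.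
  have := sxy l; rewrite !ffunE => ->.
  by rewrite -mulr2n -mulr_natr (pcharf0 char2) mulr0.
by apply: leq_trans dxy; apply/subset_leq_card/subsetP => j; rewrite !inE vx.
Qed.

End Syndrome.

(** * The upper bound: coloring by direction, parity and syndrome *)

Definition parity n (x : vertex n) : bool := \big[addb/false]_i x i.

Lemma odd_hamming n (x y : vertex n) :
  odd (hamming x y) = parity x (+) parity y.
Proof.
rewrite /parity -big_split /hamming -sum1_card big_mkcond /=.
rewrite (big_morph odd oddD (erefl _)).
by apply: eq_bigr => i _; rewrite inE; case: (x i); case: (y i).
Qed.

Lemma hamming_flip n (x y : vertex n) i :
  x i = y i -> hamming x (flip y i) = (hamming x y).+1.
Proof.
move=> xyi; rewrite /hamming (cardsD1 i) inE ffunE xyi eqxx.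
have -> : y i != y i (+) true by case: (y i).
congr _.+1; apply: eq_card => j; rewrite !inE ffunE.
by case: eqP => [->|_] /=; rewrite ?xyi ?eqxx ?addbF.
Qed.

Lemma hamming_flip2 n (x y : vertex n) i :
  hamming (flip x i) (flip y i) = hamming x y.
Proof.
by apply: eq_card => j; rewrite !inE !ffunE; case: (x j); case: (y j); case: (j == i).
Qed.

Section UpperBound.

Variables (F : finFieldType) (char2 : 2 \in [pchar F]%R).
Variables (n : nat) (a : 'I_n -> F).
Hypotheses (a_inj : injective a) (a_neq0 : forall i, a i != 0%R).

(** Phrased as a boolean predicate on pairs so that [xchoose] can extract a base and a direction. *)
Lemma edge_baseP (e : edge n) :
  exists xi : vertex n * 'I_n,
    (xi.1 xi.2 == false) && (val e == [set xi.1; flip xi.1 xi.2]).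
Proof. by have [x [i [xi ->]]] := edgeP e; exists (x, i); rewrite xi !eqxx. Qed.

Definition base (e : edge n) : vertex n := (xchoose (edge_baseP e)).1.
Definition dir (e : edge n) : 'I_n := (xchoose (edge_baseP e)).2.

Lemma base_dir e : base e (dir e) = false.
Proof. by have /andP[/eqP] := xchooseP (edge_baseP e). Qed.

Lemma edgeE e : val e = [set base e; flip (base e) (dir e)].
Proof. by have /andP[_ /eqP] := xchooseP (edge_baseP e). Qed.

Definition bch_color s (e : edge n) : 'I_n * bool * {ffun 'I_s -> F} :=
  (dir e, parity (base e), syndrome a s (base e)).

Lemma bch_color_inj s (p : (4 * s.+1).-tuple (vertex n)) : is_Ck p ->
  {in [pred e : edge n | val e \in cycle_edges p] &, injective (bch_color s)}.
Proof.
move=> Cp e1 e2 e1p e2p [dE pE sE]; apply/eqP; apply: contraT => ne.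
have ne' : val e1 != val e2 by rewrite (inj_eq val_inj).
have [x [y [xe ye dxy]]] := Ck_edges_close Cp e1p e2p ne'.
have {}dxy : hamming x y <= s.*2.+1.
  by rewrite -leq_double (leq_trans dxy) //; clear; lia.
have db : hamming (base e1) (base e2) <= s.*2.+1.
  have b12 : base e1 (dir e2) = base e2 (dir e2) by rewrite -{1}dE !base_dir.
  move: xe ye; rewrite !edgeE !inE dE.
  (* The bases agree in the common direction: endpoints on the same side are as far apart as the
     bases, endpoints on opposite sides one further. *)
  case/orP=> /eqP Ex; case/orP=> /eqP Ey; move: dxy; rewrite Ex Ey.
  - by [].
  - by rewrite hamming_flip // => /ltnW.
  - by rewrite hamming_sym hamming_flip // hamming_sym => /ltnW.
  - by rewrite hamming_flip2.
have bE : base e1 = base e2.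
  apply: (syndrome_inj char2 a_inj a_neq0 _ sE).
  (* Equal parities make the distance even, which excludes [s.*2.+1] and leaves the range where
     syndromes are injective. *)
  have := odd_hamming (base e1) (base e2); rewrite pE addbb.
  by move: db; rewrite leq_eqVlt => /orP[/eqP ->|//]; rewrite /= odd_double.
by case/negP: ne'; rewrite !edgeE dE bE.
Qed.

Lemma f_le_bch s : f n (4 * s.+1) <= n * 2 * #|F| ^ s.
Proof.
have := f_le_card (@bch_color_inj s).
by rewrite !card_prod card_bool card_ord card_ffun card_ord.
Qed.

End UpperBound.

Lemma f_upper n s : 0 < n -> f n (4 * s.+1) <= 2 ^ s.+1 * n ^ s.+1.
Proof.
(* This exponent gives n < 2^m <= 2n, so the field has at least [n] nonzero elements. *)
move=> n0; set m := (trunc_log 2 n).+1.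
have [F c2 cF] := pPrimePowerField (isT : prime 2) (isT : 0 < m).
have nF : n <= #|[set z : F | z != 0%R]|.
  have -> : [set z : F | z != 0%R] = ~: [set 0%R] by apply/setP=> z; rewrite !inE.
  by rewrite cardsC1 cF -ltnS prednK ?expn_gt0 // trunc_log_ltn.
pose a (i : 'I_n) : F := enum_val (widen_ord nF i).
apply: leq_trans (@f_le_bch F c2 n a _ _ s) _.
- by move=> i j /enum_val_inj /(congr1 val) ij; apply: val_inj.
- by move=> i; have := enum_valP (widen_ord nF i); rewrite inE.
rewrite cF -expnMn expnS [2 * n]mulnC leq_mul //.
case: (posnP s) => [-> //|s0]; rewrite leq_exp2r // expnS mulnC leq_mul2r.
by rewrite trunc_logP.
Qed.

(** * Walks in the cube and cycles through two given edges *)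

Definition walk n (v : vertex n) (s : seq 'I_n) : seq (vertex n) :=
  v :: scanl (@flip n) v s.

(** Nested brackets w1 .. wr M wr .. w1: as flips, each bracket pair cancels, so a walk gets longer
    but ends where [M] leads. *)
Fixpoint wrap (T : Type) (W M : seq T) : seq T :=
  if W is w :: W' then w :: rcons (wrap W' M) w else M.

Section Walks.
Variable n : nat.
Implicit Types (u v : vertex n) (s W M : seq 'I_n).

Lemma size_wrap W M : size (wrap W M) = (size W).*2 + size M.
Proof. by elim: W => //= w W IH; rewrite size_rcons IH. Qed.

Lemma mem_wrap W M : wrap W M =i W ++ M.
Proof.
elim: W => //= w W IH j; rewrite !inE mem_rcons inE IH.
by rewrite orbA orbb.
Qed.

Lemma foldl_flipE v s j : foldl (@flip n) v s j = v j (+) odd (count_mem j s).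
Proof.
elim: s v => [|a s IH] v /=; first by rewrite addbF.
by rewrite IH ffunE oddD addbA eq_sym; case: (a == j).
Qed.

Lemma foldl_flip_notin v s j : j \notin s -> foldl (@flip n) v s j = v j.
Proof. by move=> js; rewrite foldl_flipE (count_memPn js) addbF. Qed.

Lemma foldl_wrap v W M : foldl (@flip n) v (wrap W M) = foldl (@flip n) v M.
Proof.
elim: W v => //= w W IH v; rewrite foldl_rcons IH.
apply/ffunP=> j; rewrite ffunE !foldl_flipE ffunE.
by case: (v j); case: (j == w); case: odd.
Qed.

Lemma last_walk v s : last v (scanl (@flip n) v s) = foldl (@flip n) v s.
Proof. by elim: s v => /=. Qed.

Lemma size_walk v s : size (walk v s) = (size s).+1.
Proof. by rewrite /= size_scanl. Qed.

Lemma path_walk v s : path (@adj n) v (scanl (@flip n) v s).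
Proof. by elim: s v => //= a s IH v; rewrite adj_flip IH. Qed.

Lemma walk_rcons v s a :
  walk v (rcons s a) = rcons (walk v s) (flip (foldl (@flip n) v s) a).
Proof. by rewrite /walk scanl_rcons foldl_rcons. Qed.

Lemma walk_wrap_cons v w W M :
  walk v (wrap (w :: W) M) =
  v :: rcons (walk (flip v w) (wrap W M)) (foldl (@flip n) v M).
Proof.
have -> : foldl (@flip n) v M =
          flip (foldl (@flip n) (flip v w) (wrap W M)) w.
  by rewrite -foldl_rcons -(foldl_wrap v (w :: W)).
by rewrite -walk_rcons.
Qed.

Lemma walk_flip v s i : walk (flip v i) s = map (@flip n ^~ i) (walk v s).
Proof.
rewrite /walk /=; congr (_ :: _); elim: s v => //= a s IH v.
have flipC : flip (flip v i) a = flip (flip v a) i.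
  by apply/ffunP=> j; rewrite !ffunE addbAC.
by rewrite flipC IH.
Qed.

Lemma walk_notin u v s j : u \in walk v s -> j \notin s -> u j = v j.
Proof.
elim: s v => [|a s IH] v; first by rewrite inE => /eqP ->.
rewrite !inE negb_or => /orP[/eqP -> //|us] /andP[ja js].
by rewrite (IH _ us js) ffunE (negbTE ja) addbF.
Qed.

(** The first coordinate flipped is never flipped back, so the start is not revisited. *)
Lemma uniq_walk v s : uniq s -> uniq (walk v s).
Proof.
elim: s v => //= a s IH v /andP[na us].
rewrite -/(walk (flip v a) s) IH // andbT; apply/negP => /walk_notin /(_ na).
by rewrite ffunE eqxx; case: (v a).
Qed.

(** The outermost bracket [w] is flipped on all of the inner walk but not at the two ends; the ends
    differ in the first coordinate of [M]. *)
Lemma uniq_walk_wrap v W M :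
  uniq (W ++ M) -> M != [::] -> uniq (walk v (wrap W M)).
Proof.
elim: W v => [|w W IH] v; first by move=> /uniq_walk.
rewrite cat_cons cons_uniq => /andP[nw us] M0.
have {}IH := IH (flip v w) us M0.
have nws : w \notin wrap W M by rewrite mem_wrap.
have nwM : w \notin M by apply: contra nw; rewrite mem_cat orbC => ->.
rewrite walk_wrap_cons.
have far u : u w = v w -> u \notin walk (flip v w) (wrap W M).
  move=> uw; apply/negP => /walk_notin /(_ nws); rewrite uw ffunE eqxx.
  by case: (v w).
rewrite cons_uniq mem_rcons rcons_uniq IH inE negb_or !far //; last first.
  by rewrite foldl_flip_notin.
rewrite !andbT; case: M M0 us {far IH nws nwM nw} => // m M _.
rewrite cat_uniq => /and3P[_ _ /= /andP[nm _]]; apply/eqP => /ffunP/(_ m).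
by rewrite /= foldl_flip_notin // ffunE eqxx; case: (v m).
Qed.

Lemma walk_wrap u v W M : u \in walk v (wrap W M) ->
  exists2 u', u' \in walk v M & forall j, j \notin W -> u j = u' j.
Proof.
elim: W v u => [|w W IH] v u; first by exists u.
rewrite walk_wrap_cons inE mem_rcons inE => /or3P[/eqP->|/eqP->|].
- by exists v; rewrite ?mem_head.
- by exists (foldl (@flip n) v M); rewrite // -last_walk mem_last.
case/IH=> u0 + uu; rewrite walk_flip => /mapP[u' u'M E]; exists u' => // j.
by rewrite inE negb_or => /andP[jw jW]; rewrite uu // E ffunE (negbTE jw) addbF.
Qed.

End Walks.

Lemma next_cat (T : eqType) (p1 p2 : seq T) a b :
  uniq (p1 ++ a :: b :: p2) -> next (p1 ++ a :: b :: p2) a = b.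
Proof. by move=> U; rewrite -(next_rot (size p1) U) rot_size_cat /= eqxx. Qed.

Lemma next_last (T : eqType) (p : seq T) a :
  uniq (a :: p) -> next (a :: p) (last a p) = a.
Proof. by move=> U; rewrite next_nth mem_last index_last // nth_default. Qed.

(* The cycle runs from v to v' = v + D along D, and back from v' + y to v + x
   while keeping coordinate x or y set; flipping W back and forth on the way
   adjusts the length. *)
Lemma cycle_through_edges n (v : vertex n) x y (D W : seq 'I_n) :
  uniq (W ++ D) -> x \notin W ++ D -> y \notin W ++ D ->
  v x = false -> v y = false -> (x != y) || (D != [::]) ->
  let v' := foldl (@flip n) v D in
  exists p : seq (vertex n),
    [/\ size p = (size W + size D + (x != y)).*2.+2, ucycle (@adj n) p,
        [set v; flip v x] \in cycle_edges p
      & [set v'; flip v' y] \in cycle_edges p].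
Proof.
move=> UWD xWD yWD vx vy xyD v'.
(* The way back from v' + y to v + x. When [x] and [y] differ, [x] is set first and [y] cleared
   last, so one of them is always set. *)
set M := if x == y then D else x :: rcons D y.
have [xW xD] : x \notin W /\ x \notin D.
  by move: xWD; rewrite mem_cat negb_or => /andP.
have [yW yD] : y \notin W /\ y \notin D.
  by move: yWD; rewrite mem_cat negb_or => /andP.
have M0 : M != [::] by rewrite /M; case: eqP xyD.
have UWM : uniq (W ++ M).
  rewrite /M; case: (eqVneq x y) => // nxy; move: UWD; rewrite !cat_uniq /=.
  rewrite mem_rcons inE (negbTE nxy) (negbTE xD) rcons_uniq yD (negbTE xW) /=.
  by rewrite has_rcons (negbTE yW).
pose o := flip v' y.
have lastE : foldl (@flip n) o (wrap W M) = flip v x.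
  rewrite foldl_wrap; apply/ffunP=> j; rewrite foldl_flipE !ffunE foldl_flipE.
  rewrite /M; case: (eqVneq x y) => [->|nxy] /=; last first.
    rewrite -cats1 count_cat /= addn0 !oddD [x == j]eq_sym [y == j]eq_sym.
    by case: (v j); case: (j == x); case: (j == y); case: odd.
  by case: (v j); case: (j == y); case: odd.
have v'y : v' y = false by rewrite /v' foldl_flip_notin.
have inner u : u \in walk v D -> u x || u y = false.
  by move=> uD; rewrite !(walk_notin uD) // vx vy.
have outer u : u \in walk o (wrap W M) -> u x || u y.
  case/walk_wrap=> u' u'M uu'; rewrite !uu' //; move: u'M.
  rewrite /M; case: (eqVneq x y) => [->|nxy] u'M.
    by rewrite (walk_notin u'M) // ffunE v'y eqxx.
  move: u'M; rewrite inE => /orP[/eqP->|]; first by rewrite !ffunE v'y eqxx orbT.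
  move/walk_notin/(_ (_ : x \notin rcons D y)); rewrite mem_rcons inE negb_or nxy.
  by move=> ->; rewrite // !ffunE foldl_flip_notin // vx (negbTE nxy) eqxx.
pose p := walk v D ++ walk o (wrap W M).
have Up : uniq p.
  rewrite cat_uniq uniq_walk ?(uniq_walk_wrap _ UWM M0) ?andbT //; last first.
    by move: UWD; rewrite cat_uniq => /and3P[].
  (* The two halves are disjoint: [x] and [y] are both clear on the way out and never both clear on
     the way back. *)
  by apply/hasPn => u /outer uxy; apply/negP => /inner; rewrite uxy.
have v'E : last v (scanl (@flip n) v D) = v' := last_walk v D.
have pE : p = v :: (scanl (@flip n) v D ++ walk o (wrap W M)) by [].
have lastp : last v (scanl (@flip n) v D ++ walk o (wrap W M)) = flip v x.
  by rewrite last_cat /= last_walk lastE.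
exists p; split.
- have sM : size M = size D + (x != y).*2.
    by rewrite /M; case: eqP => _ /=; rewrite ?size_rcons ?addn0 ?addn2.
  rewrite size_cat !size_walk size_wrap sM.
  by move: (size D) (size W) (nat_of_bool _) => d w b; clear; lia.
- rewrite /ucycle Up andbT pE /= rcons_path cat_path path_walk lastp v'E /=.
  rewrite adj_flip path_walk /=; apply/adjP; exists x; by rewrite flipK.
- apply/imsetP; exists (flip v x); first by rewrite pE -lastp mem_last.
  have -> : next p (flip v x) = v by rewrite pE -lastp next_last // -pE.
  by rewrite setUC.
apply/imsetP; exists v'; first by rewrite mem_cat -{1}v'E mem_last.
have -> : p = belast v (scanl (@flip n) v D) ++ v' :: o :: scanl (@flip n) o (wrap W M).
  by rewrite -v'E -cat_rcons -lastI.
by rewrite next_cat // -v'E -cat_rcons -lastI.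
Qed.

(** * The lower bound: a large family of edges, pairwise on common cycles *)

Lemma foldl_flip_diff n (v v' : vertex n) :
  foldl (@flip n) v (enum [set i | v i != v' i]) = v'.
Proof.
apply/ffunP=> j; rewrite foldl_flipE count_uniq_mem ?enum_uniq // mem_enum inE.
by case: (v j); case: (v' j).
Qed.

(* Coordinates are split into s + 1 blocks of length q followed by 2(s + 1)
   spare ones. A function g selects a coordinate in each of the first s blocks,
   giving the vertex [point g]; directions [dirn a] come from the last block. *)
Section LowerBound.

Variables n s q : nat.
Hypothesis fit : s.+1 * q + s.+1.*2 <= n.

Lemma lt_block (i : 'I_s) (a : 'I_q) : i * q + a < s * q.
Proof.
apply: leq_trans (leq_mul (ltn_ord i) (leqnn q)).
by rewrite mulSn addnC ltn_add2r.
Qed.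

Lemma coord_subproof (i : 'I_s) (a : 'I_q) : i * q + a < n.
Proof.
by apply: leq_trans fit; apply: leq_trans (lt_block i a) _; rewrite mulSn; lia.
Qed.

Lemma dirn_subproof (a : 'I_q) : s * q + a < n.
Proof.
by apply: leq_trans fit; have := ltn_ord a; rewrite mulSn; lia.
Qed.

Lemma spare_subproof (l : 'I_s.+1.*2) : s.+1 * q + l < n.
Proof. by apply: leq_trans fit; rewrite ltn_add2l. Qed.

Definition coord i a : 'I_n := Ordinal (coord_subproof i a).
Definition dirn a : 'I_n := Ordinal (dirn_subproof a).
Definition spare l : 'I_n := Ordinal (spare_subproof l).

Lemma coord_inj i j a b : coord i a = coord j b -> i = j /\ a = b.
Proof.
have q0 : 0 < q by apply: leq_trans (ltn_ord a).
move=> /(congr1 val) /= E; have ij : i = j :> nat.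
  by have := congr1 (divn^~ q) E; rewrite !divnMDl // !divn_small // !addn0.
split; apply: val_inj => //=; apply/eqP; move/eqP: E.
by rewrite ij eqn_add2l.
Qed.

Definition point (g : {ffun 'I_s -> 'I_q}) : vertex n :=
  [ffun c => c \in [set coord i (g i) | i : 'I_s]].

Lemma point_inj : injective point.
Proof.
move=> g h /ffunP E; apply/ffunP => i; have := E (coord i (g i)).
rewrite !ffunE => {}E.
have : coord i (g i) \in [set coord i (h i) | i : 'I_s].
  by rewrite -E; apply/imsetP; exists i.
by case/imsetP=> j _ /coord_inj[-> ->].
Qed.

Lemma point_high g (c : 'I_n) : s * q <= c -> point g c = false.
Proof.
move=> hc; rewrite ffunE; apply/imsetP => -[i _ E].
by have := lt_block i (g i); rewrite ltnNge -[_ + _]/(val (coord i (g i))) -E hc.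
Qed.

Lemma hamming_point g h : hamming (point g) (point h) <= s.*2.
Proof.
pose supp g := [set coord i (g i) | i : 'I_s].
have card_supp g' : #|supp g'| <= s.
  by apply: leq_trans (leq_imset_card _ _) _; rewrite card_ord.
rewrite -addnn; apply: leq_trans (leq_add (card_supp g) (card_supp h)).
apply: leq_trans (leq_card_setU _ _); apply/subset_leq_card/subsetP => c.
by rewrite !inE !ffunE; case: (c \in supp g); case: (c \in supp h).
Qed.

Lemma star_edge_subproof (ga : {ffun 'I_s -> 'I_q} * 'I_q) :
  [set point ga.1; flip (point ga.1) (dirn ga.2)] \in edges n.
Proof.
rewrite inE; apply/existsP; exists (point ga.1).
by apply/existsP; exists (flip (point ga.1) (dirn ga.2)); rewrite adj_flip eqxx.
Qed.

Definition star_edge ga : edge n := 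
  exist (fun e => e \in edges n) _ (star_edge_subproof ga).

Lemma dirn_inj : injective dirn.
Proof. by move=> a b /(congr1 val) /addnI /val_inj. Qed.

Lemma point_dirn g a : point g (dirn a) = false.
Proof. by rewrite point_high // leq_addr. Qed.

(** No [point] has a coordinate of the last block set, while the other endpoint has exactly the
    direction there; this recovers both. *)
Lemma star_edge_inj : injective star_edge.
Proof.
case=> [g a] [h b] /(congr1 val) /= E.
have gh : g = h.
  have := set21 (point g) (flip (point g) (dirn a)).
  rewrite E => /set2P[/point_inj //|/ffunP/(_ (dirn b))].
  by rewrite flipE !point_dirn eqxx.
rewrite {}gh in E *; congr (_, _); apply: dirn_inj.
have := set22 (point h) (flip (point h) (dirn a)).
rewrite E => /set2P[] /ffunP/(_ (dirn a)); rewrite !flipE !point_dirn eqxx //=.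
by move/esym/eqP.
Qed.

Lemma star_edges_in_cycle ga hb : ga != hb ->
  exists2 p : (4 * s.+1).-tuple (vertex n), is_Ck p &
    (val (star_edge ga) \in cycle_edges p) &&
    (val (star_edge hb) \in cycle_edges p).
Proof.
case: ga hb => [g a] [h b] ne /=.
set D := enum [set i | point g i != point h i].
have sD : size D <= s.*2 by rewrite -cardE hamming_point.
(* The number of spare coordinates that brings the cycle to length 4(s + 1). As [size D] is at most
   [s.*2], the subtraction does not truncate. *)
pose m := s.*2.+1 - size D - (dirn a != dirn b).
pose W := map spare (take m (enum 'I_s.+1.*2)).
have sW : size W = m.
  by rewrite size_map size_takel // size_enum_ord /m; move: (nat_of_bool _) => r; clear; lia.
have WE c : c \in W -> s.+1 * q <= c.
  by case/mapP=> l _ ->; rewrite leq_addr.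
have DE c : c \in D -> c < s * q.
  by rewrite ltnNge mem_enum inE; apply: contraNN => hc; rewrite !point_high.
have UWD : uniq (W ++ D).
  rewrite cat_uniq enum_uniq andbT map_inj_uniq ?take_uniq ?enum_uniq //=.
    apply/hasPn => c /DE cD; apply/negP => /WE; rewrite leqNgt.
    by rewrite (leq_trans cD) // leq_mul2r leqnSn orbT.
  by move=> l l' /(congr1 val) /addnI /val_inj.
have dWD r : dirn r \notin W ++ D.
  rewrite mem_cat negb_or; apply/andP; split; apply/negP.
    by move/WE; rewrite leqNgt /= mulSn addnC ltn_add2r ltn_ord.
  by move/DE; rewrite ltnNge leq_addr.
have neD : (dirn a != dirn b) || (D != [::]).
  rewrite -negb_and; apply: contra ne => /andP[/eqP/dirn_inj -> /eqP D0].
  by have := foldl_flip_diff (point g) (point h); rewrite -/D D0 => /point_inj ->.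
have [p [sp Cp e1 e2]] := cycle_through_edges UWD (dWD a) (dWD b)
  (point_dirn g a) (point_dirn g b) neD.
have {}sp : size p == 4 * s.+1.
  rewrite sp sW /m; move: sD (leq_b1 (dirn a != dirn b)).
  by move: (size D) (nat_of_bool _) => d r; clear; lia.
rewrite foldl_flip_diff in e2.
exists (Tuple sp); last by rewrite e1.
by apply/andP; split; [clear; lia | exact: Cp].
Qed.

Lemma f_lower_blocks : q ^ s.+1 <= f n (4 * s.+1).
Proof.
have [c /rainbowP Rc] := existsP (f_colorable n (4 * s.+1)).
have cI : injective (fun ga => c (star_edge ga)).
  move=> ga hb E; apply/eqP; apply: contraT => ne.
  have [p Cp /andP[e1 e2]] := star_edges_in_cycle ne.
  by case/eqP: ne; apply/star_edge_inj/(Rc p Cp).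
have := leq_card _ cI.
by rewrite card_prod card_ffun !card_ord expnS mulnC.
Qed.

End LowerBound.

(** * The lower bound for every positive n, and the constants *)

Lemma f_gt0 n k : 0 < n -> 0 < f n k.
Proof.
case: n => // n _; have /existsP[c _] := f_colorable n.+1 k.
pose v : vertex n.+1 := [ffun=> false].
have eE : [set v; flip v ord0] \in edges n.+1.
  rewrite inE; apply/existsP; exists v; apply/existsP; exists (flip v ord0).
  by rewrite adj_flip eqxx.
by apply: leq_ltn_trans (ltn_ord (c (exist (fun e => e \in edges n.+1) _ eE))).
Qed.

Lemma f_lower n s :
  0 < n -> n ^ s.+1 <= (4 * s.+1) ^ s.+1 * f n (4 * s.+1).
Proof.
(* For small [n] the constant alone exceeds the power of [n], and one color suffices. *)
move=> n0; have [n_small | n_large] := ltnP n (4 * s.+1).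
  apply: leq_trans (leq_pmulr _ (f_gt0 _ n0)).
  by rewrite leq_exp2r // ltnW.
(* The largest block length that fits; for n >= 4(s + 1) it satisfies n <= 4(s + 1)q. *)
pose q := (n - s.+1.*2) %/ s.+1.
have fit : s.+1 * q + s.+1.*2 <= n.
  have := leq_divM (n - s.+1.*2) s.+1; rewrite -/q mulnC.
  move: n_large; move: (s.+1 * q) (s.+1) => r t; clear; lia.
apply: leq_trans (_ : (4 * s.+1 * q) ^ s.+1 <= _).
  rewrite leq_exp2r // -mulnA.
  have := ltn_ceil (n - s.+1.*2) (isT : 0 < s.+1); rewrite -/q mulSn mulnC.
  move: n_large; move: (s.+1 * q) (s.+1) => r t; clear; lia.
by rewrite expnMn leq_mul2l f_lower_blocks // orbT.
Qed.

Local Open Scope ring_scope.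

Theorem theorem1 (R : realType) (k : nat) (hk4 : (4 <= k)%N)
    (hkmod : (k = 0 %[mod 4])%N) :
  exists c1 c2 : R, [/\ 0 < c1, 0 < c2 &
    forall n : nat, (k <= 2 ^ n)%N ->
      c1 * n%:R ^+ (k %/ 4) < (f n k)%:R < c2 * n%:R ^+ (k %/ 4)].
Proof.
have [s ->] : exists s, k = (4 * s.+1)%N.
  by exists (k %/ 4).-1; move: hk4 hkmod; clear; lia.
rewrite mulKn //; set K := ((4 * s.+1) ^ s.+1)%N.
have K0 : (0 < K)%N by rewrite expn_gt0.
(* Doubling [K] and adding 1 to 2^(s + 1) turn the weak bounds into strict ones. *)
exists (K.*2)%:R^-1, (2 ^ s.+1).+1%:R; split; rewrite ?invr_gt0 ?ltr0n ?double_gt0 //.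
move=> n kn; have n0 : (0 < n)%N by case: n kn; rewrite // expn0; clear; lia.
rewrite ltr_pdivrMl ?ltr0n ?double_gt0 // -!natrX -!natrM !ltr_nat.
apply/andP; split.
  apply: leq_ltn_trans (f_lower s n0) _.
  by rewrite ltn_pmul2r ?f_gt0 // -addnn -[X in (X < _)%N]addn0 ltn_add2l.
apply: leq_ltn_trans (f_upper s n0) _.
by rewrite ltn_pmul2r ?expn_gt0 ?n0.
Qed.
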